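(* Let $(W,S)$ be a finitely generated Coxeter system (i.e. $S$ finite). The polynomial (or formal power series, if $W$ is infinite) $W(t,\mathbf q)$ satisfies $$W(t,\mathbf q)=\sum_{T\subseteq S}W_T(t)\prod_{s\in T}q_s\prod_{s\in S\setminus T}(1-q_s).$$
   Context: A Coxeter system $(W,S)$ is a group $W$ with generating set $S$ and presentation $W=\langle S\mid (s_1s_2)^{m(s_1,s_2)}=1 \text{ whenever } m(s_1,s_2)\neq\infty\rangle$, where $m\colon S\times S\to\{1,2,\dots,\infty\}$ is symmetric and $m(s_1,s_2)=1$ iff $s_1=s_2$. $|w|$ is the word length of $w\in W$ with respect to $S$, and $S_w\subseteq S$ (the colour of $w$) is the set of generators occurring in a reduced word of $w$ (independent of the reduced word). For $T\subseteq S$, $W_T$ is the subgroup generated by $T$. For $X\subseteq W$ put $X(t)=\sum_{w\in X}t^{|w|}$, and $X(t,\mathbf q)=\sum_{w\in X}t^{|w|}\prod_{s\in S_w}q_s$, formal power series in $t$ and the indeterminates $\mathbf q=(q_s)_{s\in S}$. *)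

(* Defs.v *)
From HB Require Import structures.
From mathcomp Require Import all_boot all_algebra finmap.
From mathcomp Require Import mpoly.
From mathcomp Require Import boolp classical_sets functions cardinality fsbigop.

Set Implicit Arguments.
Unset Strict Implicit.
Unset Printing Implicit Defensive.

Import GRing.Theory.

Local Open Scope classical_set_scope.
Local Open Scope ring_scope.

(* Formal power series in one variable t, with the Cauchy product.            *)
Record fps (A : Type) := Fps { coef_fps :> nat -> A }.

HB.instance Definition _ (A : Type) := [isNew for @coef_fps A].
HB.instance Definition _ (A : choiceType) := [Choice of fps A by <:].

Lemma fpsP (A : Type) (f g : fps A) : f =1 g -> f = g.
Proof. by case: f g => [f] [g] /= /funext ->. Qed.

Section FpsRing.
Variable A : comNzRingType.
Implicit Types f g h : fps A.

Definition fps_zero : fps A := Fps (fun=> 0).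
Definition fps_one : fps A := Fps (fun n => (n == 0%N)%:R).
Definition fps_opp f : fps A := Fps (fun n => - f n).
Definition fps_add f g : fps A := Fps (fun n => f n + g n).
Definition fps_mul f g : fps A := Fps (fun n => \sum_(j < n.+1) f j * g (n - j)%N).

Fact fps_addA : associative fps_add.
Proof. by move=> f g h; apply: fpsP => n /=; rewrite addrA. Qed.

Fact fps_addC : commutative fps_add.
Proof. by move=> f g; apply: fpsP => n /=; rewrite addrC. Qed.

Fact fps_add0 : left_id fps_zero fps_add.
Proof. by move=> f; apply: fpsP => n /=; rewrite add0r. Qed.

Fact fps_addN : left_inverse fps_zero fps_opp fps_add.
Proof. by move=> f; apply: fpsP => n /=; rewrite addNr. Qed.

HB.instance Definition _ :=
  GRing.isZmodule.Build (fps A) fps_addA fps_addC fps_add0 fps_addN.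

Let trunc n f : {poly A} := \poly_(i < n.+1) f i.

Let coef_trunc n f i : (i <= n)%N -> (trunc n f)`_i = f i.
Proof. by move=> lein; rewrite coef_poly ltnS lein. Qed.

Let coef_fps_mul n f g i : (i <= n)%N ->
  fps_mul f g i = (trunc n f * trunc n g)`_i.
Proof.
move=> lein; rewrite coefM /=; apply: eq_bigr => j _.
by rewrite !coef_trunc // (leq_trans _ lein) ?leq_subr // -ltnS ltn_ord.
Qed.

Fact fps_mulA : associative fps_mul.
Proof.
move=> f g h; apply: fpsP => n.
transitivity ((trunc n f * (trunc n g * trunc n h))`_n).
  rewrite coefM /=; apply: eq_bigr => j _.
  by rewrite coef_trunc -?(@coef_fps_mul n) ?leq_subr // -ltnS ltn_ord.
rewrite mulrA coefM /=; apply: eq_bigr => j _.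
by rewrite coef_trunc -?(@coef_fps_mul n) ?leq_subr // -ltnS ltn_ord.
Qed.

Fact fps_mulC : commutative fps_mul.
Proof. by move=> f g; apply: fpsP => n; rewrite !(@coef_fps_mul n) // mulrC. Qed.

Fact fps_mul1 : left_id fps_one fps_mul.
Proof.
move=> f; apply: fpsP => n /=.
by rewrite big_ord_recl /= mul1r subn0 big1 ?addr0 // => i _; rewrite mul0r.
Qed.

Fact fps_mulDl : left_distributive fps_mul fps_add.
Proof.
move=> f g h; apply: fpsP => n /=; rewrite -big_split /=.
by apply: eq_bigr => j _; rewrite mulrDl.
Qed.

Fact fps_oner_neq0 : fps_one != 0.
Proof.
by apply/eqP => /(congr1 (fun f : fps A => f 0%N)) /= /eqP; rewrite oner_eq0.
Qed.

HB.instance Definition _ := GRing.Zmodule_isComNzRing.Build (fps A)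
  fps_mulA fps_mulC fps_mul1 fps_mulDl fps_oner_neq0.

Definition fpsC (a : A) : fps A := Fps (fun n => if n == 0%N then a else 0).
Definition fpsX : fps A := Fps (fun n => (n == 1%N)%:R).

(* The sum over w in X of a family of power series which is locally finite,   *)
(* i.e. for each n only finitely many w in X have F w n <> 0 (otherwise the   *)
(* n-th coefficient is a default value).                                      *)
Definition fps_sum (I : choiceType) (X : set I) (F : I -> fps A) : fps A :=
  Fps (fun n => \sum_(w \in X) F w n).

Lemma coef_fps_sum (I : Type) (r : seq I) (P : pred I) (F : I -> fps A) n :
  (\sum_(i <- r | P i) F i) n = \sum_(i <- r | P i) F i n.
Proof.
elim: r => [|i r IHr]; first by rewrite !big_nil.
by rewrite !big_cons; case: (P i); rewrite -IHr.
Qed.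

Lemma coef_fpsCM a f n : (fpsC a * f) n = a * f n.
Proof.
rewrite [LHS]big_ord_recl /= subn0 big1 ?addr0 // => i _; exact: mul0r.
Qed.

Lemma coef_fpsXM f n : (fpsX * f) n = if n is k.+1 then f k else 0.
Proof.
rewrite [LHS]big_ord_recl /= mul0r add0r; case: n => [|n]; first exact: big_ord0.
rewrite big_ord_recl /= mul1r subSS subn0 big1 ?addr0 // => i _; exact: mul0r.
Qed.

Lemma coef_fpsXn k n : (fpsX ^+ k) n = (n == k)%:R.
Proof.
elim: k n => [|k IHk] [|n] //; first by rewrite exprS coef_fpsXM.
by rewrite exprS coef_fpsXM IHk eqSS.
Qed.

End FpsRing.

Section Presentation.
Variables (I : Type) (W : groupType).

(* Group words on I: (i, false) is the letter i, (i, true) its formal inverse *)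
Definition gword := seq (I * bool).

Definition gword_val (f : I -> W) (u : gword) : W :=
  (\prod_(a <- u) (if a.2 then (f a.1)^-1 else f a.1))%g.

(* Equality, in the quotient of the free group on I by the normal closure of  *)
(* the relators, of the elements represented by two words.                    *)
Inductive gword_equiv (relator : gword -> Prop) : gword -> gword -> Prop :=
| gword_equiv_refl u : gword_equiv relator u u
| gword_equiv_sym u v : gword_equiv relator u v -> gword_equiv relator v u
| gword_equiv_trans u v w :
    gword_equiv relator u v -> gword_equiv relator v w -> gword_equiv relator u w
| gword_equiv_cat u u' v v' :
    gword_equiv relator u u' -> gword_equiv relator v v' ->
    gword_equiv relator (u ++ v) (u' ++ v')
| gword_equiv_cancel i b : gword_equiv relator [:: (i, b); (i, ~~ b)] [::]
| gword_equiv_relator r : relator r -> gword_equiv relator r [::].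

(* W = < f(I) | relator > *)
Definition is_presentation (f : I -> W) (relator : gword -> Prop) : Prop :=
  (forall w, exists u, gword_val f u = w) /\
  (forall u v, gword_val f u = gword_val f v <-> gword_equiv relator u v).

End Presentation.

(* None stands for the value infinity. *)
Definition coxeter_matrix (I : Type) (m : I -> I -> option nat) : Prop :=
  [/\ forall s t, m s t <> Some 0%N,
      forall s t, m s t = m t s &
      forall s t, m s t = Some 1%N <-> s = t].

Definition coxeter_relator (I : Type) (m : I -> I -> option nat)
    (r : gword I) : Prop :=
  exists s t k, m s t = Some k /\
    r = flatten (nseq k [:: (s, false); (t, false)]).

Definition coxeter_system (W : groupType) (S : {fset W})
    (m : S -> S -> option nat) : Prop :=
  coxeter_matrix m /\ is_presentation (fun s : S => val s) (coxeter_relator m).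

Section Words.
Variables (W : groupType) (S : {fset W}).

Definition word_val (u : seq S) : W := (\prod_(s <- u) val s)%g.

(* Inverse letters are not needed, the generators of a Coxeter system being   *)
(* involutions.                                                               *)
Definition reduced_word (w : W) (u : seq S) : Prop :=
  word_val u = w /\ forall v, word_val v = w -> (size u <= size v)%N.

Definition a_reduced_word (w : W) : seq S := xget [::] [set u | reduced_word w u].

Definition word_length (w : W) : nat := size (a_reduced_word w).

(* This is meant for Coxeter systems, where it does not depend on the choice  *)
(* of the reduced word.                                                       *)
Definition colour (w : W) : {set S} := [set s in a_reduced_word w]%SET.

Definition is_subgroup (H : set W) : Prop :=
  [/\ H 1%g, forall x y, H x -> H y -> H (x * y)%g & forall x, H x -> H (x^-1)%g].

Definition generated_subgroup (T : {set S}) : set W :=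
  smallest is_subgroup [set val s | s in [set s | s \in T]].

Definition qring := {mpoly int[#|{: S}|]}.

Definition qvar (s : S) : fps qring := fpsC 'X_(enum_rank s).

Definition growth_series (X : set W) : fps qring :=
  fps_sum X (fun w => fpsX _ ^+ word_length w).

Definition coloured_growth_series (X : set W) : fps qring :=
  fps_sum X (fun w => fpsX _ ^+ word_length w * \prod_(s in colour w) qvar s).

End Words.

Section CoxeterWords.
Variables (W : groupType) (S : {fset W}) (m : S -> S -> option nat).
Hypothesis hWS : coxeter_system m.

Lemma coxeter_invol (s : S) : (val s * val s = 1)%g.
Proof.
have [[_ _ m1] [_ /(_ [:: (s, false); (s, false)] [::]) [_ H]]] := hWS.
move: H; rewrite /gword_val !big_cons big_nil /= mulg1; apply.
by apply: gword_equiv_relator; exists s, s, 1%N; split => //; apply/m1.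
Qed.

Lemma coxeter_word_ex (w : W) : exists u : seq S, word_val u = w.
Proof.
have [_ [/(_ w) [u <-] _]] := hWS; exists (map fst u).
rewrite /word_val /gword_val big_map; apply: eq_bigr => -[s []] //= _.
by apply: (mulgI (val s)); rewrite mulgV coxeter_invol.
Qed.

Lemma a_reduced_wordP (w : W) : reduced_word w (a_reduced_word S w).
Proof.
apply: (@xgetPex _ [::] [set u | reduced_word w u]).
have ex : exists n, `[< exists2 u : seq S, word_val u = w & size u = n >].
  by have [u uw] := coxeter_word_ex w; exists (size u); apply/asboolP; exists u.
have [n /asboolP [u uw <-] min] := ex_minnP ex.
by exists u; split=> // v vw; apply: min; apply/asboolP; exists v.
Qed.

(* The family defining the growth series is locally finite. *)
Lemma finite_word_length n : finite_set [set w | word_length S w = n].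
Proof.
apply: (@sub_finite_set _ _ ((fun u : n.-tuple S => word_val u) @` setT)).
  move=> w /= /eqP wn; exists (Tuple wn) => //=.
  by have [] := a_reduced_wordP w.
exact/finite_image/finite_finset.
Qed.

End CoxeterWords.

(* Main.v *)
Require Import Defs.
From mathcomp Require Import all_boot all_algebra finmap.
From mathcomp Require Import mpoly.
From mathcomp Require Import boolp classical_sets functions cardinality fsbigop.

Set Implicit Arguments.
Unset Strict Implicit.
Unset Printing Implicit Defensive.

Import GRing.Theory.

Local Open Scope classical_set_scope.
Local Open Scope ring_scope.

(** Summing over the sets [T] that contain a fixed set [C], the products
    [\prod_(s in T) q s * \prod_(s in ~: T) (1 - q s)] add up to
    [\prod_(s in C) q s]: the letters outside [C] contribute
    [q s + (1 - q s) = 1] each ([sum_supersets]).  Taking for [C] the colour of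
    [w] and summing over [w], the left-hand side becomes the sum, over all pairs
    [(T, w)] such that [w] has colour in [T], of this weight; this is the
    right-hand side as soon as the elements whose colour is contained in [T]
    are exactly those of the subgroup generated by [T].

    That last fact ([generated_subgroup_colour]) is where the Coxeter relations
    are used: if [w] is the value of a word [v] in the letters of [T], then all
    the letters of a reduced word [u] of [w] have to occur in [v].  To a word
    [s_1 ... s_k] attach the sequence of its reflections
    [s_1 ... s_(i-1) s_i s_(i-1) ... s_1].  For each [r], the parity of the
    number of occurrences of [r] in that sequence depends only on the value of
    the word ([odd_reflections_eq]); it suffices to check this on the relators
    [(s t)^k], whose reflections [(s t)^j s], with [j < 2k], occur in equal
    pairs.  The reflections of a reduced word are pairwise distinct, since
    otherwise two letters could be deleted, so each of them is a reflection of
    every other word with the same value ([reflections_sub]).  In particular the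
    first letter [s] of [u] is a reflection of [v], so that [s w] is the value of
    a subword of [v] ([exchange]).  Hence [s] is the value of a word in the
    letters of [v]; a reduced subword of it has length 1, so [s] is one of these
    letters.  Induction on [u] does the rest ([letters_sub]). *)

(** * Reflections of a word *)
Section Reflections.
Variables (W : groupType) (S : {fset W}).

Fixpoint reflections (u : seq S) : seq W :=
  if u is s :: u' then val s :: [seq (r ^ (val s)^-1)%g | r <- reflections u']
  else [::].

Lemma word_val_cons (s : S) u : word_val (s :: u) = (val s * word_val u)%g.
Proof. by rewrite /word_val big_cons. Qed.

Lemma word_val_cat (u v : seq S) :
  word_val (u ++ v) = (word_val u * word_val v)%g.
Proof. by rewrite /word_val big_cat. Qed.

Lemma size_reflections u : size (reflections u) = size u.
Proof. by elim: u => //= s u IHu; rewrite size_map IHu. Qed.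

Lemma reflections_cat u v :
  reflections (u ++ v) =
  reflections u ++ [seq (r ^ (word_val u)^-1)%g | r <- reflections v].
Proof.
elim: u => [|s u IHu] /=.
  rewrite -[LHS]map_id; apply: eq_map => r.
  by rewrite /word_val big_nil invg1 conjg1.
rewrite IHu map_cat -map_comp word_val_cons; congr (_ :: _ ++ _).
by apply: eq_map => r /=; rewrite invgM conjgM.
Qed.

Lemma count_mem_conj (g r : W) (l : seq W) :
  count_mem r [seq (x ^ g^-1)%g | x <- l] = count_mem (r ^ g)%g l.
Proof.
rewrite count_map; apply: eq_count => x /=.
by rewrite -(inj_eq (@conjg_inj W g)) conjgKV.
Qed.

(** The cocycle identity that makes [(r, e) |-> (r ^ word_val u, e')], where [e']
    is [e] shifted by the parity of the occurrences of [r], a right action of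
    words on signed group elements; it reduces the invariance of the parity
    to the defining relations. *)
Lemma odd_reflections_cat r u v :
  odd (count_mem r (reflections (u ++ v))) =
  odd (count_mem r (reflections u))
    (+) odd (count_mem (r ^ word_val u)%g (reflections v)).
Proof. by rewrite reflections_cat count_cat oddD count_mem_conj. Qed.

End Reflections.

(** * Parity, exchange and deletion in a Coxeter group *)

Section Exchange.
Variables (W : groupType) (S : {fset W}) (m : S -> S -> option nat).
Hypothesis hWS : coxeter_system m.

Lemma coxeter_inv (s : S) : ((val s)^-1 = val s)%g.
Proof. by apply: (mulgI (val s)); rewrite mulgV (coxeter_invol hWS). Qed.

Lemma word_val_rev u : word_val (rev u : seq S) = ((word_val u)^-1)%g.
Proof.
elim: u => [|s u IHu]; first by rewrite /rev /= /word_val big_nil invg1.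
rewrite rev_cons -cats1 word_val_cat IHu !word_val_cons /word_val big_nil.
by rewrite mulg1 invgM coxeter_inv.
Qed.

Lemma gword_val_word_val (u : gword S) :
  gword_val (fun s : S => val s) u = word_val (map fst u).
Proof.
rewrite /gword_val /word_val big_map; apply: eq_bigr => -[s []] //= _.
exact: coxeter_inv.
Qed.

Lemma reflections_alternating (s t : S) k :
  reflections (flatten (nseq k [:: s; t])) =
  mkseq (fun j => (val s * val t) ^+ j * val s)%g k.*2.
Proof.
set c := (val s * val t)%g.
elim: k => [|k IHk] //=.
have conj_c x :
    (((x * val s) ^ (val t)^-1) ^ (val s)^-1 = c * x * c * val s)%g.
  by rewrite !conjgE !coxeter_inv /c !mulgA.
rewrite IHk /mkseq /=; congr [:: _, _ & _].
- by rewrite mul1g.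
- by rewrite conjgE invgK coxeter_inv mulgA.
rewrite (iotaDl 2 0) -!map_comp; apply: eq_map => j.
by rewrite [LHS]conj_c -expgS -expgSr.
Qed.

(** As [(s t)^k = 1], the second half of the [2k] reflections repeats the
    first. *)
Lemma odd_reflections_relator (s t : S) k r : ((val s * val t) ^+ k = 1)%g ->
  odd (count_mem r (reflections (flatten (nseq k [:: s; t])))) = false.
Proof.
move=> ck; rewrite reflections_alternating /mkseq -addnn iotaD map_cat count_cat.
rewrite add0n -{2}[k]addn0 iotaDl -map_comp.
rewrite (@eq_map _ _ (_ \o _) (fun j => (val s * val t) ^+ j * val s)%g).
  by rewrite addnn odd_double.
by move=> j /=; rewrite expgnDr ck mul1g.
Qed.

Lemma word_val_flatten_nseq k (u : seq S) :
  word_val (flatten (nseq k u)) = (word_val u ^+ k)%g.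
Proof.
elim: k => [|k IHk]; first by rewrite /word_val big_nil.
by rewrite /= word_val_cat IHk expgS.
Qed.

(** Two words with the same value are related by the defining relations, so an
    induction on that derivation applies. Inverse letters are sent to the letters
    themselves, the generators being involutions. *)
Lemma odd_reflections_eq (u v : seq S) r : word_val u = word_val v ->
  odd (count_mem r (reflections u)) = odd (count_mem r (reflections v)).
Proof.
pose g : seq S -> gword S := map (fun s => (s, false)).
have gK w : map fst (g w) = w by rewrite -map_comp map_id.
have [_ [_ pres]] := hWS.
move=> uv; have /pres : gword_val (fun s : S => val s) (g u)
    = gword_val (fun s : S => val s) (g v).
  by rewrite !gword_val_word_val !gK.
rewrite -{2}(gK u) -{2}(gK v) => E; move: r.
elim: {u v uv} E => //=.
- by move=> u v w _ IH1 _ IH2 r; rewrite IH1.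
- move=> u u' v v' uu' IHu vv' IHv r.
  rewrite !map_cat !odd_reflections_cat IHu IHv.
  by move/pres: uu'; rewrite !gword_val_word_val => ->.
- by move=> s b r; rewrite conjgE invgK mulgV mulg1 addn0 addnn odd_double.
- move=> _ [s [t [k [mst ->]]]] r.
  rewrite map_flatten map_nseq /=; apply: odd_reflections_relator.
  have /pres : gword_equiv (coxeter_relator m)
      (flatten (nseq k [:: (s, false); (t, false)])) [::].
    by apply: gword_equiv_relator; exists s, t, k.
  rewrite !gword_val_word_val map_flatten map_nseq word_val_flatten_nseq.
  by rewrite /word_val !big_cons !big_nil mulg1.
Qed.

(** A reflection that occurs once in [u] occurs an odd number of times, hence at
    least once, in [v]. *)
Lemma reflections_sub (u v : seq S) :
  uniq (reflections u) -> word_val u = word_val v ->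
  {subset reflections u <= reflections v}.
Proof.
move=> uu uv r ru; have := odd_reflections_eq r uv.
rewrite (count_uniq_mem _ uu) ru => /esym; apply: contraTT => rv.
by rewrite (count_memPn rv).
Qed.

(** Multiplying by the [i]-th reflection of [u] amounts to erasing its [i]-th
    letter. *)
Lemma exchange r (u : seq S) : r \in reflections u -> exists v,
  [/\ subseq v u, (size v < size u)%N & word_val v = (r * word_val u)%g].
Proof.
elim: u r => //= s u IHu r; rewrite inE => /orP[/eqP->|/mapP[q /IHu]].
  exists u; split=> //; first exact: subseq_cons.
  by rewrite word_val_cons mulgA (coxeter_invol hWS) mul1g.
move=> [v [vu szv valv]] ->; exists (s :: v); split=> //=.
  by rewrite eqxx.
by rewrite !word_val_cons valv conjgE invgK !mulgA mulgVK.
Qed.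

(** If the [i]-th and [j]-th reflections coincide, multiplying twice by this
    reflection erases the [i]-th and [j]-th letters and keeps the value. *)
Lemma deletion (u : seq S) : ~~ uniq (reflections u) -> exists v,
  [/\ subseq v u, (size v < size u)%N & word_val v = word_val u].
Proof.
elim: u => //= s u IHu.
rewrite negb_and negbK map_inj_uniq; last exact: conjg_inj.
case/orP => [/mapP[r ru sr]|/IHu[v [vu szv valv]]].
  have {}sr : val s = r.
    have := congr1 (fun x => x ^ val s)%g sr.
    by rewrite conjgKV conjgE mulgA mulVg mul1g.
  have [v [vu szv valv]] := exchange ru; exists v; split.
  - exact: subseq_trans vu (subseq_cons _ _).
  - exact: ltnW.
  - by rewrite valv word_val_cons sr.
exists (s :: v); split=> //=; first by rewrite eqxx.
by rewrite !word_val_cons valv.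
Qed.

Lemma reduced_subword (u : seq S) : exists v,
  [/\ subseq v u, uniq (reflections v) & word_val v = word_val u].
Proof.
have [n] := ubnP (size u); elim: n u => // n IHn u szu.
have [uu|/deletion[v [vu szv valv]]] := boolP (uniq (reflections u)).
  by exists u.
have [w [wv uw valw]] := IHn v (leq_trans szv szu).
by exists w; split=> //; [exact: subseq_trans wv vu | rewrite valw].
Qed.

(** A subword with distinct reflections and value [s] has the same reflections as
    the one-letter word [s], so it consists of a single letter. *)
Lemma letter_in_word (s : S) v : word_val v = val s -> s \in v.
Proof.
move=> vs; have [x [xv ux xs]] := reduced_subword v.
have us : uniq (reflections [:: s]) by [].
have valx : word_val x = word_val [:: s].
  by rewrite xs vs word_val_cons /word_val big_nil mulg1.
have := uniq_leq_size ux (reflections_sub ux valx).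
have := uniq_leq_size us (reflections_sub us (esym valx)).
rewrite !size_reflections /= => sz1 sz2; apply: (mem_subseq xv).
case: x sz1 sz2 valx {xv ux xs} => [|t [|? ?]] // _ _.
rewrite /word_val !big_cons big_nil !mulg1 => /val_inj ->.
by rewrite mem_head.
Qed.

(** This contains the independence of the colour from the reduced word, and says
    more: a reduced word uses only letters that every word with its value
    uses. *)
Lemma letters_sub (u v : seq S) :
  uniq (reflections u) -> word_val u = word_val v ->
  {subset u <= v}.
Proof.
elim: u v => [|s u IHu] v //= uu uv.
have /exchange[x [xv _ valx]] : val s \in reflections v.
  by apply: (reflections_sub _ uv) => //=; rewrite mem_head.
have {IHu} ux : {subset u <= x}.
  apply: IHu.
    by move: uu => /andP[_]; rewrite map_inj_uniq //; exact: conjg_inj.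
  by rewrite valx -uv word_val_cons mulgA (coxeter_invol hWS) mul1g.
have sv : s \in v.
  (* The value of x is s times that of v, and reversing v inverts its value. *)
  have /letter_in_word : word_val (x ++ rev v) = val s.
    by rewrite word_val_cat word_val_rev valx mulgK.
  rewrite mem_cat mem_rev => /orP[|//]; exact: mem_subseq.
by move=> t; rewrite inE => /orP[/eqP->|/ux/(mem_subseq xv)].
Qed.

Lemma uniq_reflections_reduced w (u : seq S) :
  reduced_word w u -> uniq (reflections u).
Proof.
move=> [uw min]; apply/negPn/negP => /deletion[v [_ szv valv]].
by have := min v; rewrite valv leqNgt szv => /(_ uw).
Qed.

(** * Parabolic subgroups and colours *)

Lemma generated_subgroupE (T : {set S}) (w : W) :
  generated_subgroup T w <-> exists2 u, {subset u <= T} & word_val u = w.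
Proof.
split.
  pose H := [set w | exists2 u : seq S, {subset u <= T} & word_val u = w].
  apply: (@smallest_sub _ _ _ H).
    split.
    - by exists [::] => //; rewrite /word_val big_nil.
    - move=> _ _ [u uT <-] [v vT <-]; exists (u ++ v); last exact: word_val_cat.
      by move=> s; rewrite mem_cat => /orP[/uT|/vT].
    - move=> _ [u uT <-]; exists (rev u); last exact: word_val_rev.
      by move=> s; rewrite mem_rev => /uT.
  move=> _ [s /= sT <-]; exists [:: s]; first by move=> t; rewrite inE => /eqP->.
  by rewrite /word_val big_cons big_nil mulg1.
move=> [u uT <-] H [[H1 HM _] TH]; elim: u uT => [|s u IHu] uT.
  by rewrite /word_val big_nil.
rewrite word_val_cons; apply: HM.
  by apply: TH; exists s => //=; apply: uT; rewrite mem_head.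
by apply: IHu => t tu; apply: uT; rewrite inE tu orbT.
Qed.

Lemma generated_subgroup_colour (T : {set S}) (w : W) :
  generated_subgroup T w <-> colour S w \subset T.
Proof.
have red := a_reduced_wordP hWS w; rewrite generated_subgroupE; split.
  move=> [v vT vw]; apply/fintype.subsetP => s; rewrite inE => su; apply: vT.
  apply: letters_sub su; first exact: uniq_reflections_reduced red.
  by rewrite vw; case: red.
move=> /fintype.subsetP cT; exists (a_reduced_word S w); last by case: red.
by move=> s su; apply: cT; rewrite inE.
Qed.

End Exchange.

(** * Power series and inclusion-exclusion *)

Section Series.
Variable A : comNzRingType.

Lemma fpsC_prod (I : Type) (r : seq I) (P : pred I) (F : I -> A) :
  \prod_(i <- r | P i) fpsC (F i) = fpsC (\prod_(i <- r | P i) F i).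
Proof.
apply: (big_ind2 (fun f a => f = fpsC a)) => //.
- by apply: fpsP => -[].
- move=> _ a _ b -> ->; apply: fpsP => n; rewrite coef_fpsCM /=.
  by case: n => //= n; rewrite mulr0.
Qed.

Lemma fpsC_1B (a : A) : 1 - fpsC a = fpsC (1 - a).
Proof. by apply: fpsP => -[|n] //=; rewrite /= subr0. Qed.

(** Expand [\prod_i (q i + b i)], where [b i] is [1 - q i] outside [C] and [0] on
    [C]: the zeros kill the sets [T] that do not contain [C], and the factors
    outside [C] are equal to 1. *)
Lemma sum_supersets (I : finType) (C : {set I}) (q : I -> A) :
  \sum_(T : {set I} | C \subset T)
     (\prod_(i in T) q i) * (\prod_(i in ~: T) (1 - q i)) = \prod_(i in C) q i.
Proof.
pose b i := if i \in C then 0 else 1 - q i.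
transitivity (\prod_i (q i + b i)); last first.
  rewrite [RHS]big_mkcond; apply: eq_bigr => i _; rewrite /b.
  by case: (i \in C); rewrite ?addr0 // addrC subrK.
rewrite bigA_distr big_mkcond; apply: eq_bigr => T _.
have -> : \prod_i (if i \in T then q i else b i) =
    (\prod_(i in T) q i) * (\prod_(i in ~: T) b i).
  rewrite (bigID (mem T)) /=; congr (_ * _).
    by apply: eq_bigr => i ->.
  by apply: eq_big => [i|i /negbTE ->]; rewrite ?inE.
have [CT|/fintype.subsetPn[i iC iT]] := boolP (C \subset T).
  congr (_ * _); apply: eq_bigr => i; rewrite inE /b => iT.
  by rewrite (contraNF (fintype.subsetP CT i) iT).
rewrite [X in _ * X](bigD1 i) ?inE //= /b iC mul0r mulr0 //.
Qed.

(** Both growth series have this form, with [l] the word length; it turns each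
    coefficient into a sum over one finite sphere, so that sums can be
    exchanged. *)
Lemma coef_fps_sum_graded (I : choiceType) (X : set I) (l : I -> nat)
    (F : I -> A) n : finite_set [set w | l w = n] ->
  fps_sum X (fun w => fpsX A ^+ l w * fpsC (F w)) n =
  \sum_(w <- fset_set [set w | l w = n] | w \in X) F w.
Proof.
move=> fin; set r := fset_set _.
have coefE w : (fpsX A ^+ l w * fpsC (F w)) n = if w \in r then F w else 0.
  rewrite mulrC coef_fpsCM coef_fpsXn in_fset_set //.
  have [nl|nl] := eqVneq n (l w); first by rewrite mulr1 mem_set.
  by rewrite mulr0 memNset // => /= /esym /eqP; rewrite (negbTE nl).
rewrite /fps_sum.
rewrite [LHS](eq_fsbigr (fun w => if w \in r then F w else 0)); last first.
  by move=> w _; apply: coefE.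
rewrite fsbig_mkcond (fsbigTE r) => [|w wr]; last first.
  by rewrite /patch (negbTE wr) if_same.
by rewrite [RHS]big_mkcond; apply: eq_big_seq => w wr; rewrite /patch wr.
Qed.

End Series.

Theorem proposition9p1 (W : groupType) (S : {fset W})
    (m : S -> S -> option nat) (hWS : coxeter_system m) :
  coloured_growth_series S [set: W] =
  \sum_(T : {set S})
     growth_series S (generated_subgroup T)
     * (\prod_(s in T) qvar s) * (\prod_(s in ~: T) (1 - qvar s)).
Proof.
pose q (s : S) : qring S := 'X_(enum_rank s).
apply: fpsP => n; have fin := finite_word_length hWS n.
transitivity (\sum_(w <- fset_set [set w | word_length S w = n])
    \prod_(s in colour S w) q s).
  have -> : coloured_growth_series S [set: W] = fps_sum [set: W]
      (fun w => fpsX _ ^+ word_length S w * fpsC (\prod_(s in colour S w) q s)).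
    by congr fps_sum; apply/funext => w; rewrite fpsC_prod.
  by rewrite coef_fps_sum_graded //; apply: eq_bigl => w; rewrite in_setT.
rewrite coef_fps_sum.
transitivity (\sum_(T : {set S})
    \sum_(w <- fset_set [set w | word_length S w = n] | colour S w \subset T)
      (\prod_(s in T) q s) * (\prod_(s in ~: T) (1 - q s))); last first.
  apply: eq_bigr => T _.
  have -> : \prod_(s in T) qvar s = fpsC (\prod_(s in T) q s).
    by rewrite -fpsC_prod.
  have -> : \prod_(s in ~: T) (1 - qvar s) =
      fpsC (\prod_(s in ~: T) (1 - q s)).
    by rewrite -fpsC_prod; apply: eq_bigr => s _; apply: fpsC_1B.
  have -> : growth_series S (generated_subgroup T) =
      fps_sum (generated_subgroup T)
        (fun w => fpsX (qring S) ^+ word_length S w * fpsC 1).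
    congr fps_sum; apply/funext => w; rewrite -[LHS]mulr1; congr (_ * _).
    by apply: fpsP => -[].
  rewrite -mulrA [in RHS]mulrC -[in RHS]mulrA !coef_fpsCM coef_fps_sum_graded //.
  rewrite mulrA mulr_sumr.
  apply: eq_big => [w|w _]; last by rewrite mulr1.
  by apply/idP/idP => [/(generated_subgroup_colour hWS)/mem_set|/set_mem
    /(generated_subgroup_colour hWS)].
under eq_bigr do rewrite -sum_supersets big_mkcond.
by rewrite exchange_big; apply: eq_bigr => T _; rewrite -big_mkcond.
Qed.
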